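(* For all $n\ge 5$, $\mathrm{r}_n(1423)=2\,\mathrm{r}_{n-1}(1423)+\mathrm{r}_{n-3}(1423)+2$.
   Context: $\mathcal{S}_n$ is the set of permutations of $[n]$, $\pi^r$ the reversal of $\pi$. A word $w$ contains $\rho\in\mathcal{S}_k$ if some subsequence $w_{i_1}\cdots w_{i_k}$ ($i_1<\cdots<i_k$) satisfies $w_{i_a}\le w_{i_b}$ iff $\rho_a\le\rho_b$; otherwise it avoids $\rho$. $\mathcal{R}_n=\{\pi\pi^r:\pi\in\mathcal{S}_n\}$ (concatenation of $\pi$ with its reversal), and $\mathrm{r}_n(\rho)$ is the number of members of $\mathcal{R}_n$ avoiding $\rho$. *)

(* Defs.v *)
From mathcomp Require Import all_boot.

Set Implicit Arguments.
Unset Strict Implicit.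
Unset Printing Implicit Defensive.

(* Words are sequences of natural numbers.  A permutation of [n] = {1, ..., n}
   is given by its one-line notation, which also serves for patterns: 1423 is
   [:: 1; 4; 2; 3].  Positions are counted from 0, letters from 1. *)
Definition word := seq nat.

Definition perm_words (n : nat) : seq word := permutations (iota 1 n).

(* f a is the position in w of the letter playing the role of the letter at
   position a of rho. *)
Definition occurrence (w rho : word)
    (f : {ffun 'I_(size rho) -> 'I_(size w)}) : bool :=
  [forall a : 'I_(size rho), forall b : 'I_(size rho),
     (a < b) ==> (f a < f b)] &&
  [forall a : 'I_(size rho), forall b : 'I_(size rho),
     (nth 0 w (f a) <= nth 0 w (f b)) == (nth 0 rho a <= nth 0 rho b)].

Definition contains (w rho : word) : bool :=
  [exists f : {ffun 'I_(size rho) -> 'I_(size w)}, occurrence f].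

Definition avoids (w rho : word) : bool := ~~ contains w rho.

(* undup makes this a list of the distinct members of the set. *)
Definition R_words (n : nat) : seq word :=
  undup [seq p ++ rev p | p <- perm_words n].

Definition r (n : nat) (rho : word) : nat :=
  count (fun w => avoids w rho) (R_words n).

(* Main.v *)
(* An occurrence of 1423 in the word [p ++ rev p] is cut by the middle, so [p]
   is good iff it has no letters a < b < c < d appearing in the order c b d, nor
   in the order a d b, nor with a before d and c before b (the cuts at the two
   ends give nothing new).  Look at the place of the largest letter n of a good
   permutation L n R with L nonempty: the only inversions in L end in 1, and
   every letter of R other than n - 1 is below every letter of L.  Hence a good
   permutation is
   - k (k+1) ... n q with q good on 1, ..., k - 1, or
   - k ... (n-2) n (n-1) q with q good on 1, ..., k - 1, or
   - one of 2(n - 2) words obtained from 2 ... n or 2 ... (n-2) n (n-1) by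
     inserting 1 away from both ends.
   So r_n = sum_{j<n} r_j + sum_{j<n-2} r_j + 2(n-2), and the recurrence is the
   difference of two consecutive instances. *)
Require Import Defs.
From mathcomp Require Import all_boot.
From mathcomp Require Import zify.

Set Implicit Arguments.
Unset Strict Implicit.
Unset Printing Implicit Defensive.

(** * Pattern containment through positions in [nat] *)

Lemma containsP (w rho : word) :
  reflect (exists g : nat -> nat,
    [/\ forall a, a < size rho -> g a < size w,
        forall a b, a < b -> b < size rho -> g a < g b &
        forall a b, a < size rho -> b < size rho ->
          (nth 0 w (g a) <= nth 0 w (g b)) = (nth 0 rho a <= nth 0 rho b)])
    (contains w rho).
Proof.
apply: (iffP existsP) => [[f /andP[/forallP f_inc /forallP f_iso]]|[g [gw ginc giso]]].
(* [inord] needs a nonempty ordinal type, so the empty pattern is settled first. *)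
- case E: (size rho) f f_inc f_iso => [|k] f f_inc f_iso; first by exists id.
  exists (fun a => f (inord a) : nat); split=> [a _|a b ab bk|a b ak bk].
  + exact: ltn_ord.
  + move/forallP/(_ (inord b))/implyP: (f_inc (inord a)); apply.
    by rewrite !inordK // (ltn_trans ab).
  + by move/forallP/(_ (inord b))/eqP: (f_iso (inord a)); rewrite !inordK.
- exists [ffun a : 'I_(size rho) => Ordinal (gw _ (ltn_ord a))].
  apply/andP; split; apply/forallP => a; apply/forallP => b.
  + by apply/implyP => ab; rewrite !ffunE /=; apply: ginc.
  + by rewrite !ffunE /= giso.
Qed.

Lemma contains1423P (w : word) :
  reflect (exists i j k l, [/\ i < j < k, k < l < size w &
     nth 0 w i < nth 0 w k < nth 0 w l /\ nth 0 w l < nth 0 w j])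
    (contains w [:: 1; 4; 2; 3]).
Proof.
apply: (iffP (containsP _ _)) => [[g [gw ginc giso]]|[i [j [k [l [ijk klw [nikl nlj]]]]]]].
- exists (g 0), (g 1), (g 2), (g 3).
  rewrite (ginc 0 1) // (ginc 1 2) // (ginc 2 3) // gw //.
  split=> //; rewrite !ltnNge (giso 2 0) // (giso 3 2) // (giso 1 3) //.
- exists (nth 0 [:: i; j; k; l]); split=> /=.
  + by move=> [|[|[|[|a]]]] //= _; lia.
  + by move=> [|[|[|[|a]]]] [|[|[|[|b]]]] //= _ _; lia.
  + by move=> [|[|[|[|a]]]] [|[|[|[|b]]]] //= _ _; lia.
Qed.

(** * Good permutations and mirrored words *)

(** The letters [a], [b], [c], [d] play 1, 2, 3, 4; the conjuncts exclude in turn the cuts 1|423,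
    14|23 and 142|3. *)
Definition good (p : word) : Prop := forall a b c d : nat,
  a \in p -> b \in p -> c \in p -> d \in p -> a < b < c -> c < d ->
  [/\ ~~ (index c p < index b p < index d p),
      ~~ ((index a p < index d p) && (index c p < index b p)) &
      ~~ (index a p < index d p < index b p)].

Lemma nth_mirror (p : word) i : i < size (p ++ rev p) ->
  let x := nth 0 (p ++ rev p) i in
  x \in p /\ (uniq p -> i = index x p \/ i = (2 * size p).-1 - index x p).
Proof.
rewrite size_cat size_rev /= nth_cat => ip; case: ltnP => ip'.
  by split=> [|up]; [exact: mem_nth | left; rewrite index_uniq].
rewrite nth_rev; last lia.
have lt_p : size p - (i - size p).+1 < size p by lia.
by split=> [|up]; [exact: mem_nth | right; rewrite index_uniq //; lia].
Qed.

Lemma nth_mirror_index (p : word) x : x \in p ->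
  [/\ index x p < size p, nth 0 (p ++ rev p) (index x p) = x &
      nth 0 (p ++ rev p) ((2 * size p).-1 - index x p) = x].
Proof.
move=> xp; have ltx : index x p < size p by rewrite index_mem.
split=> //; first by rewrite nth_cat ltx nth_index.
rewrite nth_cat ifN; last lia.
rewrite nth_rev; last lia.
by rewrite (_ : _ - _ = index x p) ?nth_index //; lia.
Qed.

Lemma avoids_mirrorP (p : word) : uniq p ->
  reflect (good p) (avoids (p ++ rev p) [:: 1; 4; 2; 3]).
Proof.
move=> up; apply: (iffP idP) => [/contains1423P av|gp].
- move=> a b c d ap bp cp dp abc cd.
  have [la a1 a2] := nth_mirror_index ap; have [lb b1 b2] := nth_mirror_index bp.
  have [lc c1 c2] := nth_mirror_index cp; have [ld d1 d2] := nth_mirror_index dp.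
  split; apply/negP => H; apply: av.
  (* Letters before the cut use their left copy, letters after it their mirrored copy; likewise in
     the next two cases. *)
  + exists (index a p), ((2 * size p).-1 - index d p),
      ((2 * size p).-1 - index b p), ((2 * size p).-1 - index c p).
    by rewrite a1 b2 c2 d2 size_cat size_rev; split; lia.
  + exists (index a p), (index d p),
      ((2 * size p).-1 - index b p), ((2 * size p).-1 - index c p).
    by rewrite a1 b2 c2 d1 size_cat size_rev; split; lia.
  + exists (index a p), (index d p), (index b p), ((2 * size p).-1 - index c p).
    by rewrite a1 b1 c2 d1 size_cat size_rev; split; lia.
- apply/contains1423P => -[i [j [k [l [ijk klw [nikl nlj]]]]]].
  have [|ap /(_ up) Ea] := @nth_mirror p i; first lia.
  have [|dp /(_ up) Ed] := @nth_mirror p j; first lia.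
  have [|bp /(_ up) Eb] := @nth_mirror p k; first lia.
  have [|cp /(_ up) Ec] := @nth_mirror p l; first lia.
  (* Each position is a left or a mirrored copy; in every combination compatible with
     [i < j < k < l] one conjunct fails. *)
  have [] := gp _ _ _ _ ap bp cp dp nikl nlj.
  have lt_idx x : x \in p -> index x p < size p by rewrite index_mem.
  move: klw (lt_idx _ ap) (lt_idx _ bp) (lt_idx _ cp) (lt_idx _ dp).
  by rewrite size_cat size_rev; lia.
Qed.

Definition good_perms (n : nat) : seq word :=
  [seq p <- perm_words n | avoids (p ++ rev p) [:: 1; 4; 2; 3]].

Lemma mem_good_perms n p :
  reflect (perm_eq p (iota 1 n) /\ good p) (p \in good_perms n).
Proof.
rewrite mem_filter andbC mem_permutations.
apply: (iffP andP) => -[pn].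
  by move/avoids_mirrorP => gp; split=> //; apply: gp; rewrite (perm_uniq pn) iota_uniq.
by move=> gp; split=> //; apply/avoids_mirrorP; rewrite // (perm_uniq pn) iota_uniq.
Qed.

Lemma good_perms_uniq n : uniq (good_perms n).
Proof. exact/filter_uniq/permutations_uniq. Qed.

(** [undup] deletes nothing: [p] is recovered as the first half of [p ++ rev p], all lengths being
    [n]. *)
Lemma size_good_perms n : size (good_perms n) = r n [:: 1; 4; 2; 3].
Proof.
rewrite /r /R_words undup_id ?count_map ?size_filter //.
rewrite map_inj_in_uniq ?permutations_uniq // => p q.
rewrite !mem_permutations => /perm_size sp /perm_size sq /eqP.
by rewrite eqseq_cat ?sp ?sq // => /andP[/eqP].
Qed.

(** * Concatenations and increasing runs *)

Lemma pairwise_index (T : eqType) (r : rel T) (s : seq T) x y :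
  pairwise r s -> x \in s -> y \in s -> index x s < index y s -> r x y.
Proof.
move=> /(pairwiseP x) rs xs ys xy.
by have := rs (index x s) (index y s); rewrite !inE !index_mem !nth_index //; apply.
Qed.

Lemma index_catn (s t : seq nat) (x : nat) :
  index x (s ++ t) = if x \in s then index x s else size s + index x t.
Proof. exact: index_cat. Qed.

(** With [b] and the larger letters in [L], an inversion [c b] or [d b] would have to be [n n.-1],
    as [b > a >= 1]; but [d] exceeds [c], and [c] separates [b] from [d]. The other forbidden orders
    would put a letter of [R] before one of [L]. *)
Lemma good_cat (n : nat) (L R : word) :
  pairwise (fun x y => [|| x < y, y <= 1 | (x == n) && (y == n.-1)]) L ->
  all (leq^~ n) L -> all (leq 1) (L ++ R) ->
  allrel (fun x y => y < x) L R -> good R -> good (L ++ R).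
Proof.
move=> Linv /allP Ln /allP pos /allrelP LR gR a b c d ap bp cp dp abc cd.
have a_gt0 := pos a ap.
have inv x y : x \in L -> y \in L -> index x L < index y L ->
    [|| x < y, y <= 1 | (x == n) && (y == n.-1)].
  by move=> xL yL; apply: (pairwise_index Linv).
(* Whatever exceeds a letter of [L] lies in [L], so the cases follow the least of [a], [b], [c], [d]
   that lies in [L]. *)
have Lnotin x y : x \in L -> x < y -> y \in L ++ R -> y \in L.
  by move=> xL xy; rewrite mem_cat => /orP[//|/(LR _ _ xL)]; lia.
have [aL|aL] := boolP (a \in L).
  have bL : b \in L by apply: (Lnotin a) => //; lia.
  have cL : c \in L by apply: (Lnotin b) => //; lia.
  have dL : d \in L by apply: (Lnotin c) => //; lia.
  have cb := inv c b cL bL; have db := inv d b dL bL; have dn := Ln d dL.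
  by rewrite !index_catn aL bL cL dL; clear -cb db dn a_gt0 abc cd; split; lia.
have aR : a \in R by move: ap; rewrite mem_cat (negPf aL).
have [bL|bL] := boolP (b \in L).
  have cL : c \in L by apply: (Lnotin b) => //; lia.
  have dL : d \in L by apply: (Lnotin c) => //; lia.
  have cb := inv c b cL bL; have db := inv d b dL bL; have dn := Ln d dL.
  have id : index d L < size L by rewrite index_mem.
  by rewrite !index_catn (negPf aL) bL cL dL; clear -cb db dn id a_gt0 abc cd; split; lia.
have bR : b \in R by move: bp; rewrite mem_cat (negPf bL).
have [cL|cL] := boolP (c \in L).
  have dL : d \in L by apply: (Lnotin c) => //; lia.
  have id : index d L < size L by rewrite index_mem.
  by rewrite !index_catn (negPf aL) (negPf bL) cL dL; clear -id; split; lia.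
have cR : c \in R by move: cp; rewrite mem_cat (negPf cL).
have [dL|dL] := boolP (d \in L).
  have id : index d L < size L by rewrite index_mem.
  by rewrite !index_catn (negPf aL) (negPf bL) (negPf cL) dL; clear -id; split; lia.
have dR : d \in R by move: dp; rewrite mem_cat (negPf dL).
rewrite !index_catn (negPf aL) (negPf bL) (negPf cL) (negPf dL).
by have [] := gR a b c d aR bR cR dR abc cd; clear; split; lia.
Qed.

Lemma good_catr (L R : word) : uniq (L ++ R) -> good (L ++ R) -> good R.
Proof.
rewrite cat_uniq => /and3P[_ /hasPn LR _] g a b c d aR bR cR dR abc cd.
have [] := g a b c d _ _ _ _ abc cd; rewrite ?mem_cat ?aR ?bR ?cR ?dR ?orbT //.
rewrite !index_catn (negPf (LR _ aR)) (negPf (LR _ bR)) (negPf (LR _ cR)).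
by rewrite (negPf (LR _ dR)); clear; split; lia.
Qed.

Lemma index_pairwise (T : eqType) (r : rel T) (s : seq T) : uniq s ->
  (forall x y, x \in s -> y \in s -> index x s < index y s -> r x y) ->
  pairwise r s.
Proof.
case: s => [//|x0 s] us H; apply/(pairwiseP x0) => i j.
by rewrite !inE => li lj ij; apply: H; rewrite ?mem_nth ?index_uniq.
Qed.

Lemma pairwise_ltn_iota i k : pairwise ltn (iota i k).
Proof. by rewrite -sorted_pairwise ?iota_ltn_sorted //; apply: ltn_trans. Qed.

Lemma iota_cat i k l : k <= l -> iota i l = iota i k ++ iota (i + k) (l - k).
Proof. by move=> kl; rewrite -iotaD subnKC. Qed.

(** Sorting [R] and appending [L] gives a sorted rearrangement of [iota 1 n], hence [iota 1 n]
    itself. *)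
Lemma perm_iota_cat (n : nat) (L R : word) :
  perm_eq (L ++ R) (iota 1 n) -> pairwise ltn L ->
  allrel (fun x y => y < x) L R ->
  [/\ size R <= n, L = iota (size R).+1 (n - size R) &
      perm_eq R (iota 1 (size R))].
Proof.
move=> pLR sL /allrelP LR.
have sz : size L + size R = n by rewrite -size_cat (perm_size pLR) size_iota.
have le : size R <= n by lia.
have : sort leq R ++ L = iota 1 n.
  apply: (sorted_eq leq_trans anti_leq); last 1 first.
  - by rewrite perm_catC -(permPr pLR) perm_cat2l perm_sort.
  - rewrite (sorted_pairwise leq_trans) pairwise_cat.
    rewrite -(sorted_pairwise leq_trans) sort_sorted ?(sub_pairwise _ sL) //=.
    + by rewrite andbT; apply/allrelP => x y; rewrite mem_sort => xR yL; apply/ltnW/LR.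
    + by move=> x y; apply: ltnW.
    + exact: leq_total.
  - exact: iota_sorted.
rewrite (iota_cat 1 le) => /eqP; rewrite eqseq_cat ?size_sort ?size_iota //.
by case/andP=> /eqP eR /eqP eL; split=> //; rewrite -eR perm_sym perm_sort.
Qed.

Lemma cat_eq_iota (L1 L2 : word) s k : L1 ++ L2 = iota s k ->
  [/\ size L1 <= k, L1 = iota s (size L1) &
      L2 = iota (s + size L1) (k - size L1)].
Proof.
move=> e; have le : size L1 <= k.
  by rewrite -(size_iota s k) -e size_cat leq_addr.
move/eqP: e; rewrite (iota_cat s le) eqseq_cat ?size_iota //.
by case/andP=> /eqP e1 /eqP e2.
Qed.

(** Serves with [x] equal to 1: it identifies the letters around an inserted 1. *)
Lemma perm_cat_cons_sorted (L1 L2 S T : word) x :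
  pairwise ltn (L1 ++ L2) -> pairwise ltn S ->
  perm_eq ((L1 ++ x :: L2) ++ T) (x :: S ++ T) -> L1 ++ L2 = S.
Proof.
move=> s12 sS; rewrite -[x :: S ++ T]cat_cons perm_cat2r.
rewrite (permPl (permEl (perm_catCA L1 [:: x] L2))) perm_cons => e.
apply: (sorted_eq leq_trans anti_leq _ _ e); rewrite (sorted_pairwise leq_trans);
  by [apply: sub_pairwise s12 => ? ? /ltnW | apply: sub_pairwise sS => ? ? /ltnW].
Qed.

(** * The three families, for length [m.+2] *)

Definition head_run_perms m : seq word :=
  [seq iota j.+1 (m.+2 - j) ++ q | j <- iota 0 m.+2, q <- good_perms j].
(** The bound [j < m] keeps the run before [m.+2] nonempty; at [j = m] the words would already
    belong to [head_run_perms]. *)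
Definition swapped_run_perms m : seq word :=
  [seq iota j.+1 (m - j) ++ [:: m.+2, m.+1 & q] | j <- iota 0 m, q <- good_perms j].
(** Here [i] counts the letters before 1. The last word, with 1 between [m.+2] and [m.+1], is the
    case [i = m] of the second group. *)
Definition inner_one_perms m : seq word :=
  [seq iota 2 i ++ 1 :: iota i.+2 (m.+1 - i) | i <- iota 1 m] ++
  [seq iota 2 i ++ 1 :: iota i.+2 (m.-1 - i) ++ [:: m.+2; m.+1] | i <- iota 1 m.-1] ++
  [:: iota 2 m.-1 ++ [:: m.+2; 1; m.+1]].

Lemma mem_head_run m p :
  reflect (exists j q, [/\ j < m.+2, q \in good_perms j &
                           p = iota j.+1 (m.+2 - j) ++ q])
    (p \in head_run_perms m).
Proof.
apply: (iffP allpairsPdep) => [[j [q [jm gq e]]]|[j [q [jm gq e]]]]; exists j, q;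
  by move: jm; rewrite mem_iota.
Qed.

Lemma mem_swapped_run m p :
  reflect (exists j q, [/\ j < m, q \in good_perms j &
                           p = iota j.+1 (m - j) ++ [:: m.+2, m.+1 & q]])
    (p \in swapped_run_perms m).
Proof.
apply: (iffP allpairsPdep) => [[j [q [jm gq e]]]|[j [q [jm gq e]]]]; exists j, q;
  by move: jm; rewrite mem_iota.
Qed.

(** * Every good permutation lies in a family *)

(** Split [p] at its largest letter as [L], [m.+2], [R]. If 1 is in [L], then [R] holds at most
    [m.+1]. Otherwise [L] increases, and the place of [m.+1] decides the family. *)
Lemma good_perms_sub m p : 1 < m -> p \in good_perms m.+2 ->
  [\/ p \in head_run_perms m, p \in swapped_run_perms m
    | p \in inner_one_perms m].
Proof.
move=> m1 /mem_good_perms[pp gp].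
have up : uniq p by rewrite (perm_uniq pp) iota_uniq.
have memp x : (x \in p) = (0 < x < m.+3) by rewrite (perm_mem pp) mem_iota.
have np : m.+2 \in p by rewrite memp; lia.
have [L [R Ep]] : exists L R, p = L ++ m.+2 :: R.
  by case/splitPr: np => L R; exists L, R.
move: (up); rewrite {1}Ep cat_uniq => /and3P[uL /hasPn LnR /= /andP[nR uR]].
have nL : m.+2 \notin L by apply: LnR; rewrite inE eqxx.
have LR x : x \in R -> x \notin L by move=> xR; apply: LnR; rewrite inE xR orbT.
have idL (x : nat) : x \in L -> index x p = index x L by rewrite Ep index_catn => ->.
have ltL (x : nat) : x \in L -> index x L < size L by rewrite index_mem.
have idn : index m.+2 p = size L.
  by rewrite Ep index_catn (negPf nL) /= eqxx addn0.
have idR (x : nat) : x \in R -> index x p = size L + (index x R).+1.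
  move=> xR; rewrite Ep index_catn (negPf (LR _ xR)) /= ifN //.
  by apply: contraNneq nR => ->.
have inp x : x \in L -> 0 < x < m.+2.
  move=> xL; have := memp x; rewrite Ep mem_cat xL => /esym.
  have : x != m.+2 by apply: contraNneq nL => <-.
  by clear; lia.
have inpR x : x \in R -> 0 < x < m.+2.
  move=> xR; have := memp x; rewrite Ep mem_cat inE xR !orbT => /esym.
  have : x != m.+2 by apply: contraNneq nR => <-.
  by clear; lia.
have neqLR (x y : nat) : x \in L -> y \in R -> x != y.
  by move=> xL yR; apply: contraNneq (LR _ yR) => <-.
(* If [a < b], then [a], [m.+2], [b] together with [m.+1] as the 3 violate the third conjunct. *)
have gC a b : a \in L -> b \in R -> b != m.+1 -> b < a.
  move=> aL bR bm; have := inp a aL; have := inpR b bR; have := neqLR a b aL bR.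
  case: (ltnP b a) => // h1 h2 h3 h4.
  have [||||||_ _] := gp a b m.+1 m.+2; rewrite ?memp; try (clear -m1 bm h1 h2 h3 h4; lia).
  by rewrite idn (idR b bR) (idL a aL); have := ltL a aL; clear; lia.
(* An inversion [c b] of [L] with [b] above 1, followed by [m.+2], violates the first conjunct with
   1 as smallest letter. *)
have gA : pairwise (fun x y => (x < y) || (y == 1)) L.
  apply: index_pairwise => // c b cL bL cb.
  have : c != b by apply: contraTneq cb => ->; rewrite ltnn.
  have := inp c cL; have := inp b bL; case: (ltnP c b) => //= h1 h2 h3 h4.
  apply: contraT => b1.
  have [||||||+ _ _] := gp 1 b c m.+2; rewrite ?memp; try (clear -m1 b1 h1 h2 h3 h4; lia).
  by rewrite idn (idL b bL) (idL c cL); have := ltL b bL; clear -cb; lia.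
have [oL|oL] := boolP (1 \in L).
  have R0 : {subset R <= [:: m.+1]}.
    move=> x xR; rewrite inE; apply: contraT => /(gC 1 x oL xR).
    by have := inpR x xR; clear; lia.
  have [L1 [L2 EL]] : exists L1 L2, L = L1 ++ 1 :: L2.
    by case/splitPr: oL => L1 L2; exists L1, L2.
  have o12 : 1 \notin L1 ++ L2.
    move: uL; rewrite EL (perm_uniq (permEl (perm_catCA L1 [:: 1] L2))).
    by move=> /andP[].
  have s12 : pairwise ltn (L1 ++ L2).
    have : pairwise (fun x y => (x < y) || (y == 1)) (L1 ++ L2).
      apply: subseq_pairwise gA; rewrite EL.
      exact: cat_subseq (subseq_refl _) (subseq_cons _ _).
    apply: (sub_in_pairwise (P := [in L1 ++ L2])); last by apply/allP.
    move=> x y _ yL /orP[//|/eqP y1].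
    by rewrite y1 (negPf o12) in yL.
  case: R Ep {idR inpR neqLR LR LnR gC nR} uR R0 => [|x [|y R]] Ep uR R0.
  - have [|szi e1 e2] := @cat_eq_iota L1 L2 2 m.
      apply: (@perm_cat_cons_sorted _ _ _ [:: m.+2] 1) => //.
        exact: pairwise_ltn_iota.
      rewrite -EL -Ep (permPl pp) -[iota 1 m.+2]/(1 :: iota 2 m.+1).
      by rewrite (iota_cat 2 (leqnSn m)) subSnn.
    have {}e2 : L2 ++ [:: m.+2] = iota (size L1).+2 (m.+1 - size L1).
      rewrite e2 -[m.+1 - _](subnKC (leq_sub2r _ (leqnSn m))) iotaD.
      rewrite subSn // subSnn /=; congr (_ ++ [:: _]); clear -szi; lia.
    have {}Ep : p = L1 ++ 1 :: iota (size L1).+2 (m.+1 - size L1).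
      by rewrite Ep EL -catA /= e2.
    (* A leading 1 makes [p] a single run, the member of the first family with empty tail. *)
    case: (posnP (size L1)) => [L10|L10].
      apply: Or31; apply/mem_head_run; exists 0, [::]; split=> //.
        by apply/mem_good_perms; split=> // a.
      by rewrite Ep e1 L10 cats0 subn0.
    apply: Or33; rewrite [_ \in _]mem_cat; apply/orP; left.
    apply/mapP; exists (size L1); last by rewrite -e1.
    by rewrite mem_iota; clear -szi L10 m1; lia.
  - have {R0} xm : x = m.+1 by apply/eqP; have := R0 x; rewrite !inE eqxx => ->.
    rewrite {x}xm in Ep uR.
    have [|szi e1 e2] := @cat_eq_iota L1 L2 2 m.-1.
      apply: (@perm_cat_cons_sorted _ _ _ [:: m.+2; m.+1] 1) => //.
        exact: pairwise_ltn_iota.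
      rewrite -EL -Ep (permPl pp) -[iota 1 m.+2]/(1 :: iota 2 m.+1).
      rewrite (@iota_cat 2 m.-1); last by clear; lia.
      rewrite perm_cons perm_cat2l (_ : _ - _ = 2); last by clear -m1; lia.
      rewrite /= (_ : 2 + m.-1 = m.+1); last by clear -m1; lia.
      exact: (permEl (perm_catC [:: _] [:: _])).
    have {}Ep : p = L1 ++ 1 :: iota (size L1).+2 (m.-1 - size L1) ++ [:: m.+2; m.+1].
      by rewrite Ep EL -catA /= {1}e2.
    case: (posnP (size L1)) => [L10|L10].
      apply: Or32; apply/mem_swapped_run; exists 0, [::]; split=> //.
      + exact: ltnW.
      + by apply/mem_good_perms; split=> // a.
      + by rewrite Ep e1 L10 !subn0 -[m in iota 1 m](prednK (ltnW m1)).
    apply: Or33; rewrite [_ \in _]mem_cat mem_cat; apply/orP; right; apply/orP; left.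
    apply/mapP; exists (size L1); last by rewrite -e1.
    by rewrite mem_iota; clear -szi L10 m1; lia.
  - have := R0 x; have := R0 y; rewrite !inE !eqxx ?orbT => /(_ isT)/eqP ey /(_ isT)/eqP ex.
    by move: uR; rewrite ex ey /= inE eqxx.
have oR : 1 \in R.
  by have := memp 1; rewrite Ep mem_cat (negPf oL) inE /= => ->.
have sL : pairwise ltn L.
  apply: (sub_in_pairwise (P := [in L])) gA; last by apply/allP.
  move=> x y _ yL /orP[//|/eqP y1].
  by rewrite y1 (negPf oL) in yL.
(* If [m.+1] is not in [R], or [L] is empty, then [L] followed by [m.+2] increases and lies above
   all of [R]. *)
have [/andP[mR L0]|mR] := boolP ((m.+1 \in R) && (L != [::])); last first.
  have E : L ++ m.+2 :: R = (L ++ [:: m.+2]) ++ R by rewrite -catA.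
  have [|||le eL pR] := @perm_iota_cat m.+2 (L ++ [:: m.+2]) R.
  - by rewrite -E -Ep.
  - rewrite pairwise_cat sL /= andbT; apply/allrelP => x y xL; rewrite inE => /eqP->.
    by have /andP[] := inp x xL.
  - apply/allrelP => x y; rewrite mem_cat inE => /orP[xL yR|/eqP-> /inpR/andP[]//].
    apply: gC => //; apply: contraNneq mR => <-; rewrite yR /=.
    by apply: contraTneq xL => ->.
  have le' : size R < m.+2.
    have := congr1 size eL; rewrite size_cat size_iota /=; clear; lia.
  apply: Or31; apply/mem_head_run; exists (size R), R; split=> //.
    apply/mem_good_perms; split=> //; apply: (@good_catr (L ++ [:: m.+2])); by rewrite -E -Ep.
  by rewrite Ep E eL.
have [R1 [R2 ER]] : exists R1 R2, R = R1 ++ m.+1 :: R2.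
  by case/splitPr: mR => R1 R2; exists R1, R2.
have [x0 x0L] : exists x0, x0 \in L.
  by exists (head 0 L); case: (L) L0 => // x s _; rewrite mem_head.
have uR12 : uniq (m.+1 :: R1 ++ R2).
  by rewrite -(perm_uniq (permEl (perm_catCA R1 [:: m.+1] R2))) -ER.
(* Moving [m.+1] out of [R] to just before [m.+2] gives an increasing prefix above the remaining
   letters, so [perm_iota_cat] determines [L]. *)
have top : pairwise ltn (L ++ [:: m.+1; m.+2]).
  rewrite pairwise_cat sL /= ltnSn !andbT; apply/allrelP => x y xL.
  have := inp x xL; have := neqLR x _ xL mR; rewrite !inE => h1 h2 h3.
  by clear -h1 h2 h3; lia.
have permtop : perm_eq ((L ++ [:: m.+1; m.+2]) ++ R1 ++ R2) p.
  rewrite Ep ER -catA perm_cat2l.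
  apply: perm_trans (permEl (perm_catCA [:: m.+1] [:: m.+2] _)) _.
  by rewrite /= perm_cons perm_sym; exact: (permEl (perm_catCA R1 [:: m.+1] R2)).
have [|||le eL pR] := @perm_iota_cat m.+2 (L ++ [:: m.+1; m.+2]) (R1 ++ R2).
- by rewrite (permPl permtop).
- exact: top.
- apply/allrelP => x y xL yR.
  have yR' : y \in R.
    by rewrite ER; move: yR; rewrite !mem_cat inE => /orP[]->; rewrite ?orbT.
  have ym : y != m.+1 by apply: contraTneq yR => ->; case/andP: uR12.
  move: xL; rewrite mem_cat !inE => /or3P[xL|/eqP->|/eqP->]; first exact: gC.
    by have := inpR y yR'; clear -ym; lia.
  by have := inpR y yR'; clear; lia.
set j := size (R1 ++ R2) in le eL pR.
have [szL {}eL eT] := cat_eq_iota eL.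
have jm : j + size L = m.
  by have := congr1 size eT; rewrite size_iota /= ; clear -le szL; lia.
have szL0 : 0 < size L by rewrite lt0n size_eq0.
have {}eL : L = iota j.+1 (m - j) by rewrite {1}eL; congr iota; clear -jm; lia.
(* If [m.+1] directly follows [m.+2], the word is a swapped run; otherwise it will be the last word
   of [inner_one_perms]. *)
case: R1 @j ER uR12 {permtop eT} pR jm szL le eL => [|b R1] j ER uR12 pR jm szL le eL.
  rewrite /= in ER; apply: Or32; apply/mem_swapped_run; exists j, R2; split.
  - by clear -jm szL0; lia.
  - apply/mem_good_perms; split=> //; apply: (@good_catr (L ++ [:: m.+2; m.+1])).
      by rewrite -catA /= -ER -Ep.
    by rewrite -catA /= -ER -Ep.
  - by rewrite {1}Ep ER -eL.
have mR1 : m.+1 \notin b :: R1.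
  by move: uR12; rewrite cons_uniq mem_cat negb_or => /andP[/andP[]].
(* [x0 y (m+1)] is a 213 for [y] before [m+1], which forces [y = 1]; then
   [1], [m+1] and an inversion [x0 y] exclude letters [y] after [m+1]. *)
have before y : y \in b :: R1 -> y = 1.
  move=> yR1; have yR : y \in R by rewrite ER mem_cat yR1.
  have ym : y != m.+1 by apply: contraTneq uR12 => <-; rewrite cons_uniq mem_cat yR1.
  have yx := gC _ _ x0L yR ym; have y0 := inpR y yR.
  have x0m := neqLR _ _ x0L mR; have x00 := inp _ x0L.
  apply/eqP; apply: contraT => y1.
  have [||||||+ _ _] := gp 1 y x0 m.+1; rewrite ?memp; try (clear -yx y0 y1 x0m x00; lia).
  rewrite (idL x0 x0L) (idR y yR) (idR _ mR) ER !index_catn yR1.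
  have ltR1 : index y (b :: R1) < size (b :: R1) by rewrite index_mem.
  rewrite (negPf mR1) [index m.+1 (m.+1 :: _)]/= eqxx addn0.
  by have := ltL x0 x0L; move: ltR1; clear; lia.
have R1nil : R1 = [::].
  case: R1 {mR1 j pR jm le eL szL} ER uR12 before => // c R1 ER uR12 before.
  have eb : b = 1 by apply: before; rewrite inE eqxx.
  have ec : c = 1 by apply: before; rewrite !inE eqxx orbT.
  by move: uR12; rewrite eb ec /= !inE /= andbF.
have b1 : b = 1 by apply: before; rewrite inE eqxx.
have R2nil : R2 = [::].
  case: R2 {j pR jm le eL szL} ER uR12 => // y R2 ER uR12.
  have yR : y \in R by rewrite ER mem_cat !inE eqxx !orbT.
  have ym : y != m.+1.
    by apply: contraTneq uR12 => <-; rewrite cons_uniq mem_cat [y \in y :: _]inE eqxx orbT.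
  have y1 : y != 1.
    apply: contraTneq uR12 => ->.
    by rewrite b1 /= !mem_cat [1 \in 1 :: _]inE /= orbT andbF.
  have yx := gC _ _ x0L yR ym; have y0 := inpR y yR.
  have x0m := neqLR _ _ x0L mR; have x00 := inp _ x0L.
  have [||||||_ + _] := gp 1 y x0 m.+1; rewrite ?memp; try (clear -yx y0 y1 x0m x00; lia).
  have i1 : index 1 R < index m.+1 R.
    by rewrite ER !index_catn (negPf mR1) b1 mem_head /= addSn.
  rewrite (idL x0 x0L) (idR y yR) (idR _ mR) (idR _ oR).
  by have := ltL x0 x0L; clear -i1; lia.
apply: Or33; rewrite [_ \in _]mem_cat mem_cat; apply/orP; right; apply/orP; right.
by rewrite mem_seq1 Ep ER R1nil R2nil b1 eL /j R1nil R2nil /= subn1.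
Qed.

(** * The families consist of good permutations *)

Lemma good_perms_cat n (L R : word) :
  pairwise (fun x y => [|| x < y, y <= 1 | (x == n) && (y == n.-1)]) L ->
  allrel (fun x y => y < x) L R -> good R -> perm_eq (L ++ R) (iota 1 n) ->
  L ++ R \in good_perms n.
Proof.
move=> Linv LR gR pLR; apply/mem_good_perms; split=> //.
have LRn x : x \in L ++ R -> 0 < x <= n.
  by rewrite (perm_mem pLR) mem_iota.
apply: (good_cat Linv) => //; apply/allP => x.
  by move=> xL; have/LRn/andP[] : x \in L ++ R by rewrite mem_cat xL.
by case/LRn/andP.
Qed.

Lemma head_run_good m p : p \in head_run_perms m -> p \in good_perms m.+2.
Proof.
case/mem_head_run => j [q [jm /mem_good_perms[pq gq] ->]].
apply: good_perms_cat => //.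
- by apply: sub_pairwise (pairwise_ltn_iota _ _) => x y /= ->.
- apply/allrelP => x y; rewrite (perm_mem pq) !mem_iota; lia.
- by rewrite perm_catC (iota_cat 1 (ltnW jm)) perm_cat2r.
Qed.

Lemma swapped_run_good m p : p \in swapped_run_perms m -> p \in good_perms m.+2.
Proof.
case/mem_swapped_run => j [q [jm /mem_good_perms[pq gq] ->]].
(* The left part is the run with [m.+2] and [m.+1], whose only inversion is the permitted one. *)
rewrite -(cat1s m.+2) -(cat1s m.+1) !catA; apply: good_perms_cat => //.
- rewrite -catA pairwise_cat /= !eqxx !orbT /= andbT; apply/andP; split.
    by apply/allrelP => x y; rewrite mem_iota !inE; lia.
  by apply: sub_pairwise (pairwise_ltn_iota _ _) => x y /= ->.
- apply/allrelP => x y; rewrite (perm_mem pq) !mem_cat !inE !mem_iota; lia.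
- rewrite perm_catC (@iota_cat 1 j); last lia.
  apply: perm_cat => //; rewrite (@iota_cat (1 + j) (m - j) (m.+2 - j)); last lia.
  rewrite -catA perm_cat2l (_ : m.+2 - j - (m - j) = 2); last lia.
  rewrite (_ : 1 + j + (m - j) = m.+1); last lia.
  exact: (permEl (perm_catC [:: _] [:: _])).
Qed.

Lemma inner_one_good m p : 1 < m ->
  p \in inner_one_perms m -> p \in good_perms m.+2.
Proof.
move=> m1; rewrite !mem_cat mem_seq1.
have n_iota : iota 1 m.+2 = 1 :: iota 2 m.-1 ++ [:: m.+1; m.+2].
  rewrite -[iota 1 _]/(1 :: iota 2 m.+1).
  rewrite (@iota_cat 2 m.-1 m.+1); last lia.
  rewrite (_ : m.+1 - m.-1 = 2); last lia.
  rewrite (_ : 2 + m.-1 = m.+1) //; lia.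
case/or3P=> [/mapP[i]|/mapP[i]|/eqP]; rewrite ?mem_iota.
(* The whole word is the left part and the right part is empty; likewise in the other two groups. *)
- move=> im ->; rewrite -[X in X \in _]cats0; apply: good_perms_cat => //.
  + rewrite pairwise_cat /=; apply/and3P; split.
    * by apply/allrelP => x y; rewrite inE !mem_iota; lia.
    * by apply: sub_pairwise (pairwise_ltn_iota _ _) => x y /= ->.
    * apply/andP; split; first by apply/allP => x; rewrite mem_iota; lia.
      by apply: sub_pairwise (pairwise_ltn_iota _ _) => x y /= ->.
  + by apply/allrelP.
  + rewrite cats0 (permPl (permEl (perm_catCA _ [:: 1] _))).
    by rewrite -[iota 1 _]/(1 :: iota 2 m.+1) perm_cons -iota_cat //; lia.
- move=> im ->; rewrite -[X in X \in _]cats0; apply: good_perms_cat => //.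
  + rewrite pairwise_cat /= pairwise_cat /= !eqxx !orbT /= !andbT.
    apply/and3P; split; [..|apply/and3P; split].
    * by apply/allrelP => x y; rewrite inE mem_cat !inE !mem_iota; lia.
    * by apply: sub_pairwise (pairwise_ltn_iota _ _) => x y /= ->.
    * by apply/allP => x; rewrite mem_cat mem_iota !inE; lia.
    * by apply/allrelP => x y; rewrite mem_iota !inE; lia.
    * by apply: sub_pairwise (pairwise_ltn_iota _ _) => x y /= ->.
  + by apply/allrelP.
  + rewrite cats0 (permPl (permEl (perm_catCA _ [:: 1] _))) n_iota perm_cons.
    rewrite catA -iota_cat ?perm_cat2l; last lia.
    exact: (permEl (perm_catC [:: _] [:: _])).
- move=> ->; rewrite -[X in X \in _]cats0; apply: good_perms_cat => //.
  + rewrite pairwise_cat /= !eqxx !orbT /= !andbT.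
    apply/andP; split; first by apply/allrelP => x y; rewrite !inE !mem_iota; lia.
    rewrite ltnS (ltnW m1) andbT.
    by apply: sub_pairwise (pairwise_ltn_iota _ _) => x y /= ->.
  + by apply/allrelP.
  + rewrite cats0 n_iota -(cat1s m.+2) catA.
    rewrite (permPl (permEl (perm_catCA _ [:: 1] _))) perm_cons -catA perm_cat2l.
    exact: (permEl (perm_catC [:: _] [:: _])).
Qed.

(** * The families are free of repetitions and disjoint *)

Lemma head_iota_cat s k (q : word) : 0 < k -> head 0 (iota s k ++ q) = s.
Proof. by case: k. Qed.

(** The first letter [j.+1] recovers [j], and cancelling the run then recovers the tail. *)
Lemma head_run_uniq m : uniq (head_run_perms m).
Proof.
apply: allpairs_uniq_dep => [|j _|x y]; rewrite ?iota_uniq ?good_perms_uniq //.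
case/allpairsPdep=> j [q [+ _ ->]] /allpairsPdep[j' [q' [+ _ ->]]] /= e.
rewrite !mem_iota => jm jm'.
have [ej] : j.+1 = j'.+1.
  by have := congr1 (head 0) e; rewrite !head_iota_cat //; lia.
move/eqP: e; rewrite -{}ej.
by rewrite eqseq_cat // => /andP[_ /eqP->].
Qed.

Lemma swapped_run_uniq m : uniq (swapped_run_perms m).
Proof.
apply: allpairs_uniq_dep => [|j _|x y]; rewrite ?iota_uniq ?good_perms_uniq //.
case/allpairsPdep=> j [q [+ _ ->]] /allpairsPdep[j' [q' [+ _ ->]]] /= e.
rewrite !mem_iota => jm jm'.
have [ej] : j.+1 = j'.+1.
  by have := congr1 (head 0) e; rewrite !head_iota_cat //; lia.
move/eqP: e; rewrite -{}ej.
by rewrite eqseq_cat // => /andP[_ /eqP[->]].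
Qed.

Lemma last_iota x s k : 0 < k -> last x (iota s k) = (s + k).-1.
Proof. by case: k => // k _; rewrite -addn1 iotaD cats1 last_rcons addnA addn1. Qed.

(* These words are told apart by their last letter and the position of 1. *)
Lemma inner_one_uniq m : 1 < m -> uniq (inner_one_perms m).
Proof.
move=> m1; pose key p := (last 0 p, index 1 p).
have idx i s : index 1 (iota 2 i ++ 1 :: s) = i.
  by rewrite index_cat mem_iota /= addn0 size_iota.
apply: (map_uniq (f := key)); rewrite /inner_one_perms !map_cat -!map_comp /=.
have -> : [seq (key \o (fun i => iota 2 i ++ 1 :: iota i.+2 (m.+1 - i))) i
             | i <- iota 1 m] = [seq (m.+2, i) | i <- iota 1 m].
  apply/eq_in_map => i; rewrite mem_iota /key /= => im.
  by rewrite idx last_cat /= last_iota; [congr pair; lia | lia].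
have -> : [seq (key \o (fun i => iota 2 i ++ 1 :: iota i.+2 (m.-1 - i) ++
                                  [:: m.+2; m.+1])) i
             | i <- iota 1 m.-1] = [seq (m.+1, i) | i <- iota 1 m.-1].
  by apply/eq_in_map => i _; rewrite /key /= idx last_cat /= last_cat.
have -> : key (iota 2 m.-1 ++ [:: m.+2; 1; m.+1]) = (m.+1, m).
  rewrite /key last_cat index_cat mem_iota size_iota /= addn1.
  by rewrite prednK // ltnW.
(* The single word supplies the index [m] missing from the second group. *)
rewrite -[[:: _]]/[seq (m.+1, i) | i <- [:: m]] -map_cat.
have -> : iota 1 m.-1 ++ [:: m] = iota 1 m.
  rewrite (@iota_cat 1 m.-1 m); last lia.
  rewrite (_ : m - m.-1 = 1); last by clear -m1; lia.
  by rewrite (_ : 1 + m.-1 = m) //; clear -m1; lia.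
rewrite cat_uniq !map_inj_uniq ?iota_uniq ?andbT; try by move=> i j [].
by apply/hasPn => _ /mapP[i _ ->]; apply/mapP => -[j _ [/eqP]]; rewrite ltn_eqF.
Qed.

(** Separates this family from the others: a run word starting with 2 has tail [[:: 1]] and so ends
    in 1. *)
Lemma inner_one_ends m p : 1 < m -> p \in inner_one_perms m ->
  head 0 p = 2 /\ 1 < last 0 p.
Proof.
move=> m1; rewrite !mem_cat mem_seq1.
case/or3P=> [/mapP[i + ->]|/mapP[i + ->]|/eqP->]; rewrite ?mem_iota => *.
- by rewrite head_iota_cat ?last_cat /= ?last_iota; lia.
- by rewrite head_iota_cat ?last_cat /= ?last_cat /=; lia.
- by rewrite head_iota_cat ?last_cat /=; lia.
Qed.

Lemma last_good_perms1 (s q : word) : q \in good_perms 1 -> last 0 (s ++ q) = 1.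
Proof.
by case/mem_good_perms=> /perm_small_eq-> // _; rewrite last_cat.
Qed.

Lemma decomposition_uniq m : 1 < m ->
  uniq (head_run_perms m ++ swapped_run_perms m ++ inner_one_perms m).
Proof.
move=> m1; rewrite (cat_uniq (head_run_perms m)) (cat_uniq (swapped_run_perms m)).
rewrite head_run_uniq swapped_run_uniq inner_one_uniq //= andbT.
apply/andP; split; apply/hasPn => p.
- rewrite mem_cat => pBC; apply/negP => /mem_head_run[j [q [jm gq Ep]]].
  have hp : head 0 p = j.+1 by rewrite Ep head_iota_cat //; lia.
  case/orP: pBC => [/mem_swapped_run[j' [q' [jm' _ Ep']]]|/inner_one_ends[] // hp2].
    have ej : j' = j.
      by move: hp; rewrite Ep' head_iota_cat => [[]|] //; lia.
    (* At position [m - j] the plain run has [m.+1] and the swapped one [m.+2]. *)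
    have := congr1 (nth 0 ^~ (m - j)) Ep; rewrite Ep' {}ej in jm' *.
    rewrite !nth_cat !size_iota ltnn subnn /= ifT ?nth_iota; lia.
  by have j1 : j = 1 by [lia]; rewrite j1 in gq Ep; rewrite Ep last_good_perms1.
- case/inner_one_ends=> // hp2 lp; apply/negP => /mem_swapped_run[j [q [jm gq Ep]]].
  have hp : head 0 p = j.+1 by rewrite Ep head_iota_cat //; lia.
  have j1 : j = 1 by lia.
  rewrite j1 in gq Ep; move: lp.
  by rewrite Ep -[_ :: _ :: q]/([:: _; _] ++ q) catA last_good_perms1.
Qed.

(** * Counting and the recurrence *)

Lemma r_sum m : 1 < m ->
  r m.+2 [:: 1; 4; 2; 3] = \sum_(0 <= j < m.+2) r j [:: 1; 4; 2; 3] +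
    \sum_(0 <= j < m) r j [:: 1; 4; 2; 3] + 2 * m.
Proof.
move=> m1; rewrite -size_good_perms.
rewrite (perm_size (uniq_perm (good_perms_uniq _) (decomposition_uniq m1) _)).
  rewrite (size_cat (head_run_perms m)) (size_cat (swapped_run_perms m)).
  (* The three groups have [m], [m.-1] and 1 words. *)
  rewrite (_ : size (inner_one_perms m) = 2 * m); last first.
    by rewrite !size_cat !size_map !size_iota /=; lia.
  rewrite /head_run_perms /swapped_run_perms !size_allpairs_dep !sumnE !big_map.
  rewrite /index_iota !subn0.
  under eq_bigr do rewrite size_good_perms.
  under [X in _ + (X + _)]eq_bigr do rewrite size_good_perms.
  lia.
move=> p; rewrite (mem_cat p (head_run_perms m)) (mem_cat p (swapped_run_perms m)).
apply/idP/or3P; first exact: good_perms_sub.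
case; [exact: head_run_good | exact: swapped_run_good | exact: inner_one_good].
Qed.

Theorem theorem12 (n : nat) (hn : 5 <= n) :
  r n [:: 1; 4; 2; 3] =
    2 * r (n - 1) [:: 1; 4; 2; 3] + r (n - 3) [:: 1; 4; 2; 3] + 2.
Proof.
have [m -> m1] : exists2 m, n = m.+3 & 1 < m by exists (n - 3); lia.
(* Expand at [m.+1], peel off the top terms at [m.+2] and [m], and use [r_sum] at [m] for the rest;
   the linear terms differ by 2. *)
rewrite subn1 !subSS subn0 [m.+3.-1]/= (r_sum (leqW m1)).
rewrite (big_nat_recr m.+2) //= (big_nat_recr m) //=.
by have := r_sum m1; lia.
Qed.
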